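(* Let $f\in\Bbbk[c]$, let $R_f=\Bbbk\langle a,c\mid ac=ca+f\rangle=\Bbbk[c][a;\delta_1]$ with $\delta_1(c)=f$, and suppose $R_f[d;\sigma_2,\delta_2]$ is an involutive skew polynomial extension (ISPE) of $\Bbbk[c]$. Then there exists $g\in\Bbbk[c]$ such that $\sigma_2(c)=c$, $\delta_2(c)=f$, $\sigma_2(a)=a-g$, and $\delta_2(a)=ga$. Thus $R_f[d;\sigma_2,\delta_2]$ depends only on $f$ and $g$, and may be denoted $P(f,g)$.
   Context: $\Bbbk$ is an algebraically closed field of characteristic zero. For an automorphism $\sigma$ of a ring $R$, a $\sigma$-derivation is a $\Bbbk$-linear map $\delta:R\to R$ with $\delta(rs)=\sigma(r)\delta(s)+\delta(r)s$; the skew polynomial ring $R[x;\sigma,\delta]$ has commutation rule $xr=\sigma(r)x+\delta(r)$ for $r\in R$ (written $R[x;\delta]$ if $\sigma=\mathrm{id}$). An involutive skew polynomial extension (ISPE) of $R$ is an iterated skew polynomial ring $S=R[a;\sigma_1,\delta_1][d;\sigma_2,\delta_2]$ (with $\sigma_2$ an automorphism of, and $\delta_2$ a $\sigma_2$-derivation on, $R[a;\sigma_1,\delta_1]$) for which there is an involution $\tau\in\mathrm{Aut}(S)$ with $\tau(a)=d$, $\tau(d)=a$ and $\tau(r)=r$ for all $r\in R$.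
   Formalization: When f = 0 it is additionally assumed that σ₂(a) is not of the form h − a with h in k[c]; there the printed claim fails, e.g. f = 0, σ₂(c) = c, σ₂(a) = −a, δ₂ = 0 is an ISPE but −a is not a − g. *)

(* Defs.v *)
From HB Require Import structures.
From mathcomp Require Import all_boot all_order all_algebra.

Set Implicit Arguments.
Unset Strict Implicit.
Unset Printing Implicit Defensive.

Import GRing.Theory.
Local Open Scope ring_scope.

Definition skew_derivation (k : fieldType) (R : algType k)
    (sigma : R -> R) (delta : R -> R) : Prop :=
  forall r s : R, delta (r * s) = sigma r * delta s + delta r * s.

(* S = R[x; sigma, delta], where iota is the inclusion of R in S.  Horner
   evaluation puts coefficients on the left, so (map_poly iota p).[x] is
   \sum_i iota p`_i * x ^+ i, and the last clause says that S is a free left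
   R-module with basis 1, x, x^2, ... (in particular, iota is injective). *)
Definition is_skew_poly_ring (k : fieldType) (R S : algType k)
    (sigma : {rmorphism R -> R}) (delta : {linear R -> R})
    (iota : {lrmorphism R -> S}) (x : S) : Prop :=
  [/\ bijective sigma,
      skew_derivation sigma delta,
      (forall r : R, x * iota r = iota (sigma r) * x + iota (delta r))
    & bijective (fun p : {poly R} => (map_poly iota p).[x])].

(* A = R[a; sigma1, delta1] and S = A[d; sigma2, delta2].  A ring endomorphism
   tau with tau \o tau = id is automatically an automorphism, and it is
   k-linear since it fixes R. *)
Definition is_ISPE (k : fieldType) (R A S : algType k)
    (sigma1 : {rmorphism R -> R}) (delta1 : {linear R -> R})
    (iotaA : {lrmorphism R -> A}) (a : A)
    (sigma2 : {rmorphism A -> A}) (delta2 : {linear A -> A})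
    (iotaS : {lrmorphism A -> S}) (d : S) : Prop :=
  [/\ is_skew_poly_ring sigma1 delta1 iotaA a,
      is_skew_poly_ring sigma2 delta2 iotaS d
    & exists tau : {rmorphism S -> S},
        [/\ involutive tau,
            tau (iotaS a) = d,
            tau d = iotaS a
          & forall r : R, tau (iotaS (iotaA r)) = iotaS (iotaA r)]].

(* Main.v *)
Require Import Defs.
From HB Require Import structures.
From mathcomp Require Import all_boot all_order all_algebra.

(** The involution tau fixes k[c] and exchanges a and d, so it turns a c = c a + f
    into d c = c d + f.  Comparing with d c = sigma2(c) d + delta2(c) in the free
    left module S gives sigma2(c) = c and delta2(c) = f ([ispe_base]).

    Next, sigma2(a) = u a + v with u, v in k[c] ([ispe_sigma_affine]).  Applying
    sigma2 to a c = c a + f shows that sigma2(a) - a commutes with c.  If f <> 0,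
    the centralizer of c in Rf is k[c] in characteristic zero
    ([differential_centralizer]), and u = 1.  If f = 0, then Rf is a commutative
    polynomial ring over k[c], and its k[c]-automorphisms are affine
    ([poly_automorphism_affine]).

    Applying tau to d a = (u a + v) d + delta2(a) and rewriting the result in
    normal form gives u^2 = 1 and delta2(a) = - u v a + r0 with (u + 1) r0 = 0
    ([ispe_affine]).  Thus u = 1 or u = -1.  The second value forces f = 0 and
    sigma2(a) = v - a, the excluded case; the first one gives r0 = 0, and
    g = - v.

    Finally, a skew polynomial ring has a universal property
    ([skew_poly_ring_lift]).  Used first for Rf over k[c], where the derivation
    is determined by its value f at c, then for S over Rf, where it is enough to
    check the commutation rule of d on the generators c and a, it yields the
    isomorphism between two extensions with the same f and g. *)

Set Implicit Arguments.
Unset Strict Implicit.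
Unset Printing Implicit Defensive.

Import GRing.Theory.
Local Open Scope ring_scope.

(** * Normal forms in a skew polynomial ring *)

Definition skew_eval (k : fieldType) (R S : algType k)
    (iota : {lrmorphism R -> S}) (x : S) (p : {poly R}) : S :=
  (map_poly iota p).[x].

Section SkewEval.

Variables (k : fieldType) (R S : algType k).
Variables (iota : {lrmorphism R -> S}) (x : S).
Local Notation ev := (skew_eval iota x).

Lemma skew_eval_is_zmod_morphism : zmod_morphism ev.
Proof. by move=> p q; rewrite /skew_eval rmorphB hornerD hornerN. Qed.

End SkewEval.

HB.instance Definition _ (k : fieldType) (R S : algType k)
    (iota : {lrmorphism R -> S}) (x : S) :=
  GRing.isZmodMorphism.Build {poly R} S (skew_eval iota x)
    (skew_eval_is_zmod_morphism iota x).

Section SkewEvalTheory.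

Variables (k : fieldType) (R S : algType k).
Variables (iota : {lrmorphism R -> S}) (x : S).
Local Notation ev := (skew_eval iota x).

Lemma skew_evalZ r p : ev (r *: p) = iota r * ev p.
Proof. by rewrite /skew_eval map_polyZ hornerZ. Qed.

Lemma skew_evalC r : ev r%:P = iota r.
Proof. by rewrite /skew_eval map_polyC hornerC. Qed.

Lemma skew_evalX : ev 'X = x.
Proof. by rewrite /skew_eval map_polyX hornerX. Qed.

Lemma skew_evalXn n : ev 'X^n = x ^+ n.
Proof. by rewrite /skew_eval map_polyXn hornerXn. Qed.

Lemma skew_evalMX p : ev (p * 'X) = ev p * x.
Proof. by rewrite /skew_eval rmorphM /= map_polyX hornerMX. Qed.

Lemma skew_evalMXaddC p r : ev (p * 'X + r%:P) = ev p * x + iota r.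
Proof. by rewrite raddfD /= skew_evalMX skew_evalC. Qed.

Lemma skew_eval_linear (p : {poly R}) :
  (forall i, p`_i.+2 = 0) -> ev p = iota p`_1 * x + iota p`_0.
Proof.
move=> p_ge2; rewrite -skew_evalC -skew_evalMXaddC; congr (ev _).
by apply/polyP=> -[|[|i]]; rewrite coefD coefMX !coefC /= ?add0r ?addr0.
Qed.

End SkewEvalTheory.

Lemma skew_eval_morph (k : fieldType) (R S T : algType k)
    (iota : {lrmorphism R -> S}) (x : S) (phi : {rmorphism S -> T})
    (j : {lrmorphism R -> T}) p :
  (forall r, phi (iota r) = j r) ->
  phi (skew_eval iota x p) = skew_eval j (phi x) p.
Proof.
move=> phi_iota; elim/poly_ind: p => [|p r IHp]; first by rewrite !raddf0.
by rewrite !skew_evalMXaddC rmorphD rmorphM IHp phi_iota.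
Qed.

(** Left multiplication by x in normal form.  As x and R generate S, this and
    [skew_evalZ] determine the product of S. *)
Lemma mul_var_skew_eval (k : fieldType) (R S : algType k)
    (iota : {lrmorphism R -> S}) (x : S)
    (sigma : {rmorphism R -> R}) (delta : {linear R -> R}) p :
  (forall r, x * iota r = iota (sigma r) * x + iota (delta r)) ->
  x * skew_eval iota x p =
    skew_eval iota x (map_poly sigma p * 'X + map_poly delta p).
Proof.
move=> comm_x; elim/poly_ind: p => [|p r IHp].
  by rewrite !raddf0 mulr0 mul0r addr0 raddf0.
have mapMX (u : {additive R -> R}) :
    map_poly u (p * 'X + r%:P) = map_poly u p * 'X + (u r)%:P.
  apply/polyP=> i; rewrite coef_map !coefD !coefMX !coefC coef_map.
  by rewrite raddfD; case: (i == 0%N); rewrite ?raddf0.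
rewrite (mapMX sigma) (mapMX delta) skew_evalMXaddC mulrDr mulrA IHp comm_x.
rewrite !raddfD /= !skew_evalMX !skew_evalC !skew_evalMXaddC.
by rewrite !mulrDl addrACA.
Qed.

Section SkewPolyRing.

Variables (k : fieldType) (R S : algType k).
Variables (sigma : {rmorphism R -> R}) (delta : {linear R -> R}).
Variables (iota : {lrmorphism R -> S}) (x : S).
Hypothesis skewS : is_skew_poly_ring sigma delta iota x.
Local Notation ev := (skew_eval iota x).

Lemma skew_eval_bij : bijective ev.
Proof. by case: skewS. Qed.

Lemma skew_eval_inj : injective ev.
Proof. exact: bij_inj skew_eval_bij. Qed.

Lemma skew_var_comm r : x * iota r = iota (sigma r) * x + iota (delta r).
Proof. by case: skewS. Qed.

Lemma skew_iota_inj : injective iota.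
Proof.
by move=> r s Ers; apply: polyC_inj; apply: skew_eval_inj; rewrite !skew_evalC.
Qed.

Lemma skew_linear_inj u v u' v' :
  iota u * x + iota v = iota u' * x + iota v' -> u = u' /\ v = v'.
Proof.
move=> Euv; have: u *: 'X + v%:P = u' *: 'X + v'%:P.
  by apply: skew_eval_inj; rewrite !raddfD /= !skew_evalZ skew_evalX !skew_evalC.
move/polyP=> Ep; move: (Ep 1%N) (Ep 0%N).
by rewrite !coefD !coefZ !coefX !coefC /= !mulr1 !mulr0 !addr0 !add0r.
Qed.

Lemma skew_poly_ring_ind (P : S -> Prop) :
    (forall r, P (iota r)) -> P x ->
    (forall s t, P s -> P t -> P (s + t)) ->
    (forall s t, P s -> P t -> P (s * t)) ->
  forall s, P s.
Proof.
move=> Piota Px PD PM s; have [ev' _ evK] := skew_eval_bij.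
rewrite -[s]evK; elim/poly_ind: (ev' s) => [|p r IHp].
  by rewrite -[0]polyC0 skew_evalC.
by rewrite skew_evalMXaddC; apply: PD => //; apply: PM.
Qed.

(** The universal property of R[x; sigma, delta].  The map sending a normal
    form to its evaluation at (j, y) is additive.  The elements s such that it
    sends s t to the product of the images, for all t, form a subring; it
    contains R because normal forms have their coefficients on the left, and x
    because [mul_var_skew_eval] applies equally to x and to y. *)
Lemma skew_poly_ring_lift (T : algType k) (j : {lrmorphism R -> T}) (y : T) :
    (forall r, y * j r = j (sigma r) * y + j (delta r)) ->
  exists phi : {lrmorphism S -> T},
    [/\ forall r, phi (iota r) = j r, phi x = y
      & forall p, phi (ev p) = skew_eval j y p].
Proof.
move=> comm_y; have [ev' evK ev'K] := skew_eval_bij.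
pose phi s := skew_eval j y (ev' s).
have phi_ev p : phi (ev p) = skew_eval j y p by rewrite /phi evK.
have phiB : zmod_morphism phi.
  by move=> s t; rewrite -[s]ev'K -[t]ev'K -raddfB !phi_ev raddfB.
pose phiA := GRing.isZmodMorphism.Build S T phi phiB.
pose phia : {additive S -> T} := HB.pack phi phiA.
have phiD s t : phi (s + t) = phi s + phi t by apply: (raddfD phia).
have phi_iota r : phi (iota r) = j r by rewrite -(skew_evalC _ x) phi_ev skew_evalC.
have phi_x : phi x = y by rewrite -{1}(skew_evalX iota x) phi_ev skew_evalX.
have phi_iotaM r t : phi (iota r * t) = j r * phi t.
  by rewrite -[t]ev'K -skew_evalZ !phi_ev skew_evalZ.
have phiM s t : phi (s * t) = phi s * phi t.
  move: t; elim/skew_poly_ring_ind: s => [r|||] /=.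
  - by move=> t; rewrite phi_iotaM phi_iota.
  - move=> t; rewrite -[t]ev'K (mul_var_skew_eval _ skew_var_comm) !phi_ev.
    by rewrite phi_x (mul_var_skew_eval _ comm_y).
  - by move=> s s' IHs IHs' t; rewrite mulrDl !phiD IHs IHs' mulrDl.
  - by move=> s s' IHs IHs' t; rewrite -mulrA IHs IHs' IHs mulrA.
have phi1 : phi 1 = 1 by rewrite -(rmorph1 iota) phi_iota rmorph1.
have phiZ : scalable phi.
  move=> l s; rewrite -[l *: s]mulr_algl -(rmorph_alg iota) phi_iotaM.
  by rewrite rmorph_alg mulr_algl.
pose phim : {lrmorphism S -> T} := HB.pack phi phiA
  (GRing.isMonoidMorphism.Build S T phi (phi1, phiM))
  (GRing.isScalable.Build k S T *:%R phi phiZ).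
by exists phim; split.
Qed.

End SkewPolyRing.

(** The last hypothesis says that psi carries (sigma, delta) to
    (sigma', delta'); in this form it can be checked on generators of R. *)
Lemma skew_poly_ring_iso (k : fieldType) (R S R' S' : algType k)
    (sigma : {rmorphism R -> R}) (delta : {linear R -> R})
    (iota : {lrmorphism R -> S}) (x : S)
    (sigma' : {rmorphism R' -> R'}) (delta' : {linear R' -> R'})
    (iota' : {lrmorphism R' -> S'}) (x' : S') (psi : {lrmorphism R -> R'}) :
    is_skew_poly_ring sigma delta iota x ->
    is_skew_poly_ring sigma' delta' iota' x' -> bijective psi ->
    (forall r, x' * iota' (psi r) =
       iota' (psi (sigma r)) * x' + iota' (psi (delta r))) ->
  exists phi : {lrmorphism S -> S'},
    [/\ bijective phi, forall r, phi (iota r) = iota' (psi r) & phi x = x'].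
Proof.
move=> skewS skewS' [psi' psiK psi'K] comm_x'.
pose j : {lrmorphism R -> S'} := iota' \o psi.
have [phi [phi_iota phi_x phi_ev]] := skew_poly_ring_lift skewS (j := j) comm_x'.
exists phi; split=> //.
(* phi is the composite of three bijections: normal forms over R, normal forms
   over R', elements of S'. *)
have [ev' evK ev'K] := skew_eval_bij skewS.
have map_psi_bij : bijective (map_poly psi).
  have psi'0 : psi' 0 = 0 by rewrite -(raddf0 psi) psiK.
  exists (map_poly psi') => p; apply/polyP=> i.
    by rewrite !coef_map_id0 ?raddf0 // psiK.
  by rewrite !coef_map_id0 ?raddf0 // psi'K.
have ev'_bij : bijective ev' by exists (skew_eval iota x).
have phi_bij := bij_comp (skew_eval_bij skewS') (bij_comp map_psi_bij ev'_bij).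
apply: (eq_bij phi_bij).
by move=> s /=; rewrite -[s in RHS]ev'K phi_ev /skew_eval (map_poly_comp iota' psi).
Qed.

(** * Differential operator rings *)

Lemma poly_derivationE (k : fieldType) (delta : {linear {poly k} -> {poly k}}) p :
  skew_derivation idfun delta -> delta p = p^`() * delta 'X.
Proof.
move=> deltaM; have delta1 : delta 1 = 0.
  apply: (addrI (delta 1)); rewrite addr0 -{3}[1]mulr1 deltaM /=.
  by rewrite mul1r mulr1.
elim/poly_ind: p => [|p c IHp]; first by rewrite raddf0 deriv0 mul0r.
rewrite raddfD /= deltaM /= -alg_polyC linearZ /= delta1 scaler0 addr0 IHp.
by rewrite derivD derivM derivX alg_polyC derivC addr0 mulr1 mulrDl addrC mulrAC.
Qed.

(** The normal form of the commutator [a^n, c] in R[a; delta], with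
    f = delta(c), computed from [a^(n+1), c] = [a, c] a^n + a [a^n, c]. *)
Fixpoint comm_power (R : nzRingType) (delta : R -> R) (f : R) (n : nat) :
    {poly R} :=
  if n is n'.+1 then
    f *: 'X^n'
      + (comm_power delta f n' * 'X + map_poly delta (comm_power delta f n'))
  else 0.

Section Differential.

Variables (k : fieldType) (R A : algType k) (delta : {linear R -> R}).
Variables (iota : {lrmorphism R -> A}) (a : A).
Hypothesis skewA : is_skew_poly_ring idfun delta iota a.
Local Notation ev := (skew_eval iota a).

Lemma comm_powerE (c : R) n :
  a ^+ n * iota c = iota c * a ^+ n + ev (comm_power delta (delta c) n).
Proof.
elim: n => [|n IHn]; first by rewrite raddf0 !expr0 mulr1 mul1r addr0.
rewrite exprS -mulrA IHn mulrDr mulrA (skew_var_comm skewA) /= mulrDl.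
rewrite (mul_var_skew_eval _ (skew_var_comm skewA)) map_poly_id //.
by rewrite !raddfD /= skew_evalZ skew_evalXn -!mulrA -exprS !addrA.
Qed.

Lemma size_comm_power (f : R) n : (size (comm_power delta f n) <= n)%N.
Proof.
elim: n => [|n IHn] /=; first by rewrite size_poly0.
apply: leq_trans (size_polyD _ _) _; rewrite geq_max; apply/andP; split.
  by rewrite (leq_trans (size_scale_leq _ _)) ?size_polyXn.
apply: leq_trans (size_polyD _ _) _; rewrite geq_max; apply/andP; split.
  have [->|nz] := eqVneq (comm_power delta f n) 0; first by rewrite mul0r size_poly0.
  by rewrite size_mulX.
exact: leq_trans (size_poly _ _) (leqW IHn).
Qed.

Lemma lead_comm_power (f : R) n : (comm_power delta f n.+1)`_n = f *+ n.+1.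
Proof.
elim: n => [|n IHn].
  by rewrite /= mul0r map_poly0 !addr0 coefZ coefXn mulr1.
rewrite -[comm_power _ _ n.+2]/(f *: 'X^(n.+1)
  + (comm_power delta f n.+1 * 'X + map_poly delta (comm_power delta f n.+1))).
have := size_comm_power f n.+1.
move: (comm_power delta f n.+1) IHn => Q IHn szQ.
rewrite !coefD coefZ coefXn eqxx mulr1 coefMX /= IHn coef_map.
by rewrite nth_default // raddf0 addr0 -mulrS.
Qed.

(** If P has degree m > 0 and leading coefficient r, then [P(a), c] has degree
    m - 1 and leading coefficient m r delta(c), which is nonzero by hypothesis. *)
Lemma differential_centralizer (c : R) (b : A) :
    (forall r, r * c = c * r) ->
    (forall n r, r * delta c *+ n.+1 = 0 -> r = 0) ->
    b * iota c = iota c * b ->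
  exists r, b = iota r.
Proof.
move=> c_central delta_c_reg; have [ev' _ evK] := skew_eval_bij skewA.
rewrite -[b]evK; move: (ev' b) => P {b}.
pose Q := \sum_(i < size P) P`_i *: comm_power delta (delta c) i.
have commP : ev P * iota c = iota c * ev P + ev Q.
  rewrite -[in LHS](coefK P) -[in X in _ = _ * X + _](coefK P) !poly_def !raddf_sum /=.
  rewrite mulr_suml mulr_sumr -big_split /=; apply: eq_bigr => i _.
  rewrite !skew_evalZ skew_evalXn -mulrA comm_powerE mulrDr !mulrA.
  by rewrite -!rmorphM c_central.
rewrite commP => /(canRL (addKr _)); rewrite addNr -[RHS](raddf0 ev).
move=> /(skew_eval_inj skewA) Q0.
have [szP|szP] := leqP (size P) 1.
  by exists P`_0; rewrite (size1_polyC szP) coefC /= skew_evalC.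
case E: (size P) szP => [|[|m]] // _; case/negP: (negbT (ltnn m.+1)).
have := congr1 (fun q : {poly R} => q`_m) Q0.
rewrite /Q E big_ord_recr coefD coefZ coef0 coef_sum big1 ?add0r; last first.
  move=> i _; rewrite coefZ [X in _ * X]nth_default ?mulr0 //.
  exact: leq_trans (size_comm_power _ _) (leq_ord i).
rewrite [ord_max in comm_power _ _ ord_max]/= lead_comm_power mulrnAr.
move=> /delta_c_reg /eqP; rewrite [P`_ord_max](_ : _ = lead_coef P).
  by rewrite lead_coef_eq0 -size_poly_eq0 E.
by rewrite /lead_coef E.
Qed.

End Differential.

(** For delta = 0 the ring is the ordinary polynomial ring R[a], over which
    an automorphism fixing R is a substitution.  Degrees multiply under
    composition, so an invertible substitution is affine. *)
Lemma poly_automorphism_affine (k : fieldType) (A : algType k)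
    (iota : {lrmorphism {poly k} -> A}) (a : A)
    (delta : {linear {poly k} -> {poly k}}) (sigma : {rmorphism A -> A}) :
    is_skew_poly_ring idfun delta iota a -> (forall r, delta r = 0) ->
    bijective sigma -> (forall r, sigma (iota r) = iota r) ->
  exists u v, sigma a = iota u * a + iota v.
Proof.
move=> skewA delta0 [sigma' _ sigma'K] sigma_iota.
have comm_a r : GRing.comm a (iota r).
  by rewrite /GRing.comm (skew_var_comm skewA) delta0 raddf0 addr0.
have [ev' _ evK] := skew_eval_bij skewA.
pose Q := ev' (sigma a); pose P := ev' (sigma' a).
have evM p q : skew_eval iota a (p * q) = skew_eval iota a p * skew_eval iota a q.
  rewrite /skew_eval rmorphM hornerM_comm //; apply: comm_coef_poly => i.
  by rewrite coef_map; apply: commr_sym; apply: comm_a.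
have sigma_ev p : sigma (skew_eval iota a p) = skew_eval iota a (p \Po Q).
  elim/poly_ind: p => [|p r IHp]; first by rewrite comp_poly0 !raddf0.
  rewrite comp_poly_MXaddC skew_evalMXaddC rmorphD rmorphM IHp sigma_iota.
  by rewrite [in RHS]raddfD /= skew_evalC evM -[sigma a]evK.
have PQ : P \Po Q = 'X.
  apply: (skew_eval_inj skewA).
  by rewrite -sigma_ev /P evK sigma'K skew_evalX.
have : ((size P).-1 * (size Q).-1 = 1)%N by rewrite -size_comp_poly PQ size_polyX.
move/eqP; rewrite muln_eq1 => /andP[_ /eqP szQ].
exists Q`_1, Q`_0; rewrite -[sigma a]evK -/Q; apply: skew_eval_linear => i.
by rewrite nth_default //; case: (size Q) szQ => [|[|[|n]]].
Qed.

(** * Consequences of the involution *)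

Section ISPE.

Variables (k : fieldType) (delta1 : {linear {poly k} -> {poly k}}).
Variables (Rf S : algType k) (iotaR : {lrmorphism {poly k} -> Rf}) (a : Rf).
Variables (sigma2 : {rmorphism Rf -> Rf}) (delta2 : {linear Rf -> Rf}).
Variables (iotaS : {lrmorphism Rf -> S}) (d : S).
Hypothesis ispe : is_ISPE idfun delta1 iotaR a sigma2 delta2 iotaS d.

(** The involution turns the commutation rule of a with k[c] into the same rule
    for d. *)
Lemma ispe_var_comm r :
  d * iotaS (iotaR r) = iotaS (iotaR r) * d + iotaS (iotaR (delta1 r)).
Proof.
case: ispe => skewA _ [tau [_ tau_a _ tau_iota]].
have := congr1 (tau \o iotaS) (skew_var_comm skewA r) => /=.
by rewrite !rmorphM !rmorphD !rmorphM /= tau_a !tau_iota.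
Qed.

Lemma ispe_base r :
  sigma2 (iotaR r) = iotaR r /\ delta2 (iotaR r) = iotaR (delta1 r).
Proof.
case: ispe => _ skewS _; apply: (skew_linear_inj skewS).
by rewrite -(skew_var_comm skewS) ispe_var_comm.
Qed.

(** Let delta2(a) = \sum_i r_i a^i.  Applying tau to
    d a = (u a + v) d + delta2(a) gives
    a d = u d a + v a + \sum_i r_i d^i.
    Rewriting d a in the right-hand side and comparing the coefficients of the
    powers of d yields r_i = 0 for i > 1, then a = u (u a + v) + r_1, and
    finally 0 = u delta2(a) + v a + r_0. *)
Lemma ispe_affine u v :
    sigma2 a = iotaR u * a + iotaR v ->
  u ^+ 2 = 1 /\ exists2 r0, (u + 1) * r0 = 0
                & delta2 a = iotaR (- (u * v)) * a + iotaR r0.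
Proof.
move=> sigma_a; case: ispe => skewA skewS [tau [_ tau_a tau_d tau_iota]].
have [ev' _ evK] := skew_eval_bij skewA; pose P := ev' (delta2 a).
have tau_ev p : tau (iotaS (skew_eval iotaR a p)) =
    skew_eval iotaS d (map_poly iotaR p).
  have Ej := skew_eval_morph (phi := tau \o iotaS) (j := iotaS \o iotaR) a p tau_iota.
  rewrite -[LHS]/((tau \o iotaS) _) Ej /= tau_a.
  by rewrite /skew_eval (map_poly_comp iotaS iotaR).
have nf : a *: 'X = iotaR u *: (sigma2 a *: 'X + (delta2 a)%:P)
    + (iotaR v * a)%:P + map_poly iotaR P.
  apply: (skew_eval_inj skewS).
  rewrite !raddfD /= -tau_ev evK !skew_evalZ !skew_evalX !skew_evalC -mulrDr.
  rewrite -(skew_var_comm skewS) rmorphM /=.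
  have := congr1 tau (skew_var_comm skewS a); rewrite rmorphM rmorphD rmorphM /=.
  rewrite tau_a tau_d sigma_a rmorphD !rmorphM /= rmorphD !rmorphM /= tau_a.
  rewrite !tau_iota => ->.
  by rewrite mulrDl -!mulrA.
have nf_coef i := congr1 (fun p : {poly Rf} => p`_i) nf.
have P_ge2 i : P`_i.+2 = 0.
  move: (nf_coef i.+2); rewrite !coefD !coefZ coefD coefZ coefX !coefC coef_map /=.
  rewrite !mulr0 !addr0 mulr0 !add0r => /esym.
  by rewrite -(raddf0 iotaR) => /(skew_iota_inj skewA).
have delta_a : delta2 a = iotaR P`_1 * a + iotaR P`_0.
  by rewrite -[LHS]evK; apply: skew_eval_linear.
have [] : 1 = u ^+ 2 /\ 0 = u * v + P`_1.
  apply: (skew_linear_inj skewA); rewrite raddf0 rmorph1 mul1r addr0.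
  move: (nf_coef 1%N); rewrite !coefD !coefZ coefD coefZ coefX !coefC coef_map /=.
  rewrite !mulr1 !addr0 sigma_a mulrDr !mulrA => Ea.
  by rewrite {1}Ea expr2 rmorphD !rmorphM addrA.
move=> u2 r1; have [_ r0] : 0 = u * P`_1 + v /\ 0 = u * P`_0 + P`_0.
  apply: (skew_linear_inj skewA); rewrite !raddf0 mul0r addr0.
  move: (nf_coef 0%N); rewrite !coefD !coefZ coefD coefZ coefX !coefC coef_map /=.
  rewrite !mulr0 add0r => ->; rewrite delta_a !rmorphD !rmorphM /=.
  by rewrite mulrDr mulrDl !mulrA !addrA; congr (_ + _); rewrite addrAC.
split=> //; exists P`_0; first by rewrite mulrDl mul1r.
by rewrite delta_a; congr (iotaR _ * _ + _); apply/eqP; rewrite -addr_eq0 addrC -r1.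
Qed.

(** Since sigma2 fixes k[c], applying it to a c = c a + f and subtracting shows
    that sigma2(a) - a commutes with c.  For f <> 0 this puts sigma2(a) - a in
    k[c]; for f = 0 it carries no information, but then sigma2 is an
    automorphism of a polynomial ring in a over k[c]. *)
Lemma ispe_sigma_affine :
    [pchar k] =i pred0 ->
  exists u v, sigma2 a = iotaR u * a + iotaR v /\ (delta1 'X != 0 -> u = 1).
Proof.
move=> char0; case: ispe => skewA [sigma_bij _ _ _] _.
have sigma_iota r : sigma2 (iotaR r) = iotaR r by have [] := ispe_base r.
have [f0|f_nz] := eqVneq (delta1 'X) 0.
  have delta0 r : delta1 r = 0.
    by rewrite poly_derivationE ?f0 ?mulr0 //; case: skewA.
  have [u [v ->]] := poly_automorphism_affine skewA delta0 sigma_bij sigma_iota.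
  by exists u, v.
have [||//|r Er] := differential_centralizer skewA (c := 'X) (b := sigma2 a - a).
- by move=> r; rewrite mulrC.
- move=> n r /eqP; rewrite -mulr_natr -polyC_natr !mulf_eq0 polyC_eq0.
  by rewrite (proj1 (pcharf0P k) char0) (negPf f_nz) !orbF => /eqP.
- rewrite mulrBl mulrBr; have Ea := skew_var_comm skewA 'X.
  have := congr1 sigma2 Ea; rewrite rmorphM rmorphD rmorphM /= !sigma_iota => ->.
  by rewrite Ea /= opprD addrACA subrr addr0.
by exists 1, r; rewrite rmorph1 mul1r -Er addrC subrK.
Qed.

End ISPE.

(* c is 'X : {poly k}.  The hypothesis exceptional excludes exactly the case
   f = 0, sigma2(a) = h - a with h in k[c], where the conclusion fails: e.g.
   f = 0, sigma2(c) = c, sigma2(a) = - a, delta2 = 0 is an ISPE, with tau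
   preserving the defining relation d a = - a d. *)
Theorem proposition5p5 (k : closedFieldType) (char0 : [pchar k] =i pred0)
    (f : {poly k})
    (delta1 : {linear {poly k} -> {poly k}}) (delta1_c : delta1 'X = f)
    (Rf S : algType k)
    (iotaR : {lrmorphism {poly k} -> Rf}) (a : Rf)
    (sigma2 : {rmorphism Rf -> Rf}) (delta2 : {linear Rf -> Rf})
    (iotaS : {lrmorphism Rf -> S}) (d : S)
    (ispe : is_ISPE idfun delta1 iotaR a sigma2 delta2 iotaS d)
    (exceptional : f = 0 -> forall h : {poly k}, sigma2 a <> iotaR h - a) :
  exists g : {poly k},
    [/\ sigma2 (iotaR 'X) = iotaR 'X,
        delta2 (iotaR 'X) = iotaR f,
        sigma2 a = a - iotaR g
      & delta2 a = iotaR g * a]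
    /\
    (* the extension depends only on f and g *)
    forall (delta1' : {linear {poly k} -> {poly k}}) (Rf' S' : algType k)
        (iotaR' : {lrmorphism {poly k} -> Rf'}) (a' : Rf')
        (sigma2' : {rmorphism Rf' -> Rf'}) (delta2' : {linear Rf' -> Rf'})
        (iotaS' : {lrmorphism Rf' -> S'}) (d' : S'),
      delta1' 'X = f ->
      is_ISPE idfun delta1' iotaR' a' sigma2' delta2' iotaS' d' ->
      [/\ sigma2' (iotaR' 'X) = iotaR' 'X,
          delta2' (iotaR' 'X) = iotaR' f,
          sigma2' a' = a' - iotaR' g
        & delta2' a' = iotaR' g * a'] ->
      exists phi : {lrmorphism S -> S'},
        [/\ bijective phi,
            phi (iotaS (iotaR 'X)) = iotaS' (iotaR' 'X),
            phi (iotaS a) = iotaS' a'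
          & phi d = d'].
Proof.
have [skewA skewS _] := ispe.
have [sigma_c delta_c] := ispe_base ispe 'X.
have [u [v [sigma_a u1]]] := ispe_sigma_affine ispe char0.
have [u2 [r0 r0_eq delta_a]] := ispe_affine ispe sigma_a.
have {u1 u2} u1 : u = 1.
  have [f0|] := eqVneq f 0; last by rewrite -delta1_c.
  have /orP[/eqP//|/eqP uN1] : (u == 1) || (u == -1) by rewrite -eqf_sqr u2 expr1n.
  case: (exceptional f0 v); rewrite sigma_a uN1 rmorphN rmorph1 mulN1r addrC.
  by [].
have {r0_eq} r0_eq0 : r0 = 0.
  apply/eqP; move/eqP: r0_eq; rewrite u1 -[1 + 1]/(2%:R) -polyC_natr mulf_eq0 polyC_eq0.
  by rewrite (proj1 (pcharf0P k) char0).
subst u r0; exists (- v).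
have {}sigma_a : sigma2 a = a - iotaR (- v).
  by rewrite sigma_a rmorph1 mul1r raddfN opprK.
have {}delta_a : delta2 a = iotaR (- v) * a.
  by rewrite delta_a mul1r raddf0 addr0.
rewrite delta1_c in delta_c; split=> //.
move=> delta1' Rf' S' iotaR' a' sigma2' delta2' iotaS' d' delta1'_c ispe'.
case=> _ _ sigma_a' delta_a'; have [skewA' skewS' _] := ispe'.
have eq_delta1 r : delta1 r = delta1' r.
  have [[_ delta1M _ _] [_ delta1'M _ _]] := (skewA, skewA').
  rewrite (poly_derivationE r delta1M) (poly_derivationE r delta1'M).
  by rewrite delta1_c delta1'_c.
have [] := skew_poly_ring_iso (psi := idfun) skewA skewA'.
- by exists id.
- by move=> r /=; rewrite (skew_var_comm skewA') eq_delta1.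
move=> psi [psi_bij psi_iota psi_a].
have [] := skew_poly_ring_iso (psi := psi) skewS skewS' psi_bij.
  (* The elements of Rf satisfying the rule form a subring, so it suffices to
     treat k[c] and a. *)
  elim/(skew_poly_ring_ind skewA) => [r||r s IHr IHs|r s IHr IHs].
  - have [-> ->] := ispe_base ispe r.
    by rewrite !psi_iota /= (ispe_var_comm ispe') eq_delta1.
  - rewrite sigma_a delta_a rmorphB rmorphM /= !psi_iota psi_a /=.
    by rewrite (skew_var_comm skewS') sigma_a' delta_a'.
  - by rewrite !rmorphD /= mulrDr IHr IHs !raddfD /= mulrDl addrACA.
  - have [_ delta2M _ _] := skewS.
    rewrite delta2M !rmorphM /= mulrA IHr mulrDl -mulrA IHs !rmorphD !rmorphM /=.
    by rewrite mulrDr !mulrA !addrA.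
move=> phi [phi_bij phi_iota phi_d]; exists phi; split=> //.
  by rewrite phi_iota psi_iota.
by rewrite phi_iota psi_a.
Qed.
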